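(* Let $\mathcal{C}$ be a minor closed class of orientable matroids. If every cosimple matroid in $\mathcal{C}$ has a double circuit $D$ such that: \begin{itemize} \item $D$ has even degree and at least one singular class, or \item $D$ has odd degree and at least two singular classes, \end{itemize} then every orientation of a matroid in $\mathcal{C}$ is $coGSP$.
   Context: A matroid is cosimple if its dual is simple. A matroid is orientable if it is the underlying matroid of some oriented matroid; any such oriented matroid is an orientation of it. A double circuit of a matroid $M$ with rank function $r$ is a set $D\subseteq E(M)$ such that $r(D)=|D|-2$ and $r(D-d)=|D|-2$ for every $d\in D$. Every double circuit $D$ has a partition $(D_1,\dots,D_k)$, its circuit partition, such that the circuits of $M$ contained in $D$ are exactly the sets $D\setminus D_i$, $i\in\{1,\dots,k\}$. The degree of $D$ is $k$. A class $D_i$ is singular if $|D_i|=1$. Let $O$ be an oriented matroid on a finite set $E$. The signed vector of a signed circuit $C=(C^+,C^-)$ is the vector in $\{0,1,-1\}^E$ that equals $1$ on $C^+$, $-1$ on $C^-$ and $0$ elsewhere. The flow lattice $\mathcal{F}_O$ is the set of all integer linear combinations of signed vectors of signed circuits of $O$; its elements are the flows of $O$. A $\{0,1,-1\}$-flow is a flow all of whose entries lie in $\{0,1,-1\}$. An oriented matroid $O$ is $coGSP$ if every cosimple minor of $O$ with nonempty ground set has a nonzero $\{0,1,-1\}$-flow with at most two non-zero entries. *)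

(* Defs.v *)
From HB Require Import structures.
From mathcomp Require Import all_boot all_order all_algebra.
From mathcomp Require Import zify.

Set Implicit Arguments.
Unset Strict Implicit.
Unset Printing Implicit Defensive.

(* The ground set is a subset of an ambient finite type, so that a matroid and
   its minors live over the same type.  The rank function is total on {set T};
   mrank_ground makes it determined by its values on subsets of the ground
   set. *)
Record matroid (T : finType) : Type := Matroid {
  ground : {set T};
  mrank : {set T} -> nat;
  mrank_ground : forall A, mrank (A :&: ground) = mrank A;
  mrank_card : forall A : {set T}, mrank A <= #|A|;
  mrank_mono : forall A B : {set T}, A \subset B -> mrank A <= mrank B;
  mrank_submod : forall A B : {set T},
    mrank (A :|: B) + mrank (A :&: B) <= mrank A + mrank B
}.

Lemma mrank0 (T : finType) (M : matroid T) : mrank M set0 = 0.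
Proof. by apply/eqP; rewrite -leqn0 -(cards0 T) mrank_card. Qed.

Lemma mrankU_card (T : finType) (M : matroid T) (A B : {set T}) :
  mrank M (A :|: B) <= mrank M A + #|B|.
Proof.
by have := mrank_submod M A B; have := mrank_card M B; lia.
Qed.

Definition dependent (T : finType) (M : matroid T) (A : {set T}) : bool :=
  (A \subset ground M) && (mrank M A < #|A|).

Definition circuit (T : finType) (M : matroid T) (C : {set T}) : bool :=
  minset (dependent M) C.

Definition simple_matroid (T : finType) (M : matroid T) : Prop :=
  forall C : {set T}, circuit M C -> 2 < #|C|.

Section Dual.
Variables (T : finType) (M : matroid T).
Local Notation E := (ground M).
Local Notation r := (mrank M).

Definition dual_rank (A : {set T}) : nat := #|A :&: E| + r (E :\: A) - r E.

Lemma dual_rank_def (A : {set T}) : dual_rank A + r E = #|A :&: E| + r (E :\: A).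
Proof.
rewrite subnK // addnC -{1}(setID E A) setUC (setIC A).
exact: mrankU_card.
Qed.

Lemma dual_rank_ground (A : {set T}) : dual_rank (A :&: E) = dual_rank A.
Proof. by rewrite /dual_rank -setIA setIid setDIr setDv setU0. Qed.

Lemma dual_rank_card (A : {set T}) : dual_rank A <= #|A|.
Proof.
have := dual_rank_def A; have := mrank_mono M (subsetDl E A).
by have := subset_leq_card (subsetIl A E); lia.
Qed.

Lemma dual_rank_mono (A B : {set T}) : A \subset B -> dual_rank A <= dual_rank B.
Proof.
move=> sAB; have hA := dual_rank_def A; have hB := dual_rank_def B.
have := mrankU_card M (E :\: B) ((B :&: E) :\: (A :&: E)).
rewrite cardsDS ?setSI //; have := subset_leq_card (setSI E sAB).
suff /(mrank_mono M) : E :\: A \subset (E :\: B) :|: ((B :&: E) :\: (A :&: E)).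
  lia.
apply/subsetP=> x; rewrite !inE.
by case: (x \in A); case: (x \in B); case: (x \in E).
Qed.

Lemma dual_rank_submod (A B : {set T}) :
  dual_rank (A :|: B) + dual_rank (A :&: B) <= dual_rank A + dual_rank B.
Proof.
have := dual_rank_def A; have := dual_rank_def B.
have := dual_rank_def (A :|: B); have := dual_rank_def (A :&: B).
have := mrank_submod M (E :\: A) (E :\: B).
rewrite -setDIr -setDUr; have := cardsUI (A :&: E) (B :&: E).
rewrite -setIUl -setIIl; lia.
Qed.

Definition dual : matroid T :=
  Matroid dual_rank_ground dual_rank_card dual_rank_mono dual_rank_submod.

End Dual.

Definition cosimple (T : finType) (M : matroid T) : Prop :=
  simple_matroid (dual M).

Section Minors.
Variables (T : finType) (M : matroid T) (X : {set T}).
Local Notation E := (ground M).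
Local Notation r := (mrank M).

Definition deletion_rank (A : {set T}) : nat := r (A :\: X).

Lemma deletion_rank_ground (A : {set T}) : deletion_rank (A :&: (E :\: X)) = deletion_rank A.
Proof.
rewrite /deletion_rank -[in RHS]mrank_ground; congr r; apply/setP=> x.
by rewrite !inE; case: (x \in A); case: (x \in X); case: (x \in E).
Qed.

Lemma deletion_rank_card (A : {set T}) : deletion_rank A <= #|A|.
Proof.
exact: leq_trans (mrank_card M _) (subset_leq_card (subsetDl A X)).
Qed.

Lemma deletion_rank_mono (A B : {set T}) :
  A \subset B -> deletion_rank A <= deletion_rank B.
Proof. by move=> sAB; apply/mrank_mono/setSD. Qed.

Lemma deletion_rank_submod (A B : {set T}) :
  deletion_rank (A :|: B) + deletion_rank (A :&: B)
  <= deletion_rank A + deletion_rank B.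
Proof. by rewrite /deletion_rank setDUl setDIl; apply: mrank_submod. Qed.

Definition deletion : matroid T :=
  Matroid deletion_rank_ground deletion_rank_card deletion_rank_mono
          deletion_rank_submod.

Definition contraction_rank (A : {set T}) : nat := r (A :|: X) - r X.

Lemma contraction_rank_ground (A : {set T}) :
  contraction_rank (A :&: (E :\: X)) = contraction_rank A.
Proof.
rewrite /contraction_rank -[r (A :|: X)]mrank_ground -[r (_ :|: X)]mrank_ground.
congr (r _ - _); apply/setP=> x.
by rewrite !inE; case: (x \in A); case: (x \in X); case: (x \in E).
Qed.

Lemma contraction_rank_card (A : {set T}) : contraction_rank A <= #|A|.
Proof. by rewrite leq_subLR setUC mrankU_card. Qed.

Lemma contraction_rank_mono (A B : {set T}) :
  A \subset B -> contraction_rank A <= contraction_rank B.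
Proof. by move=> sAB; apply/leq_sub2r/mrank_mono/setSU. Qed.

Lemma contraction_rank_submod (A B : {set T}) :
  contraction_rank (A :|: B) + contraction_rank (A :&: B)
  <= contraction_rank A + contraction_rank B.
Proof.
rewrite /contraction_rank setUUl setUIl.
have := mrank_submod M (A :|: X) (B :|: X).
have := mrank_mono M (subsetUr A X); have := mrank_mono M (subsetUr B X).
have : r X <= r ((A :|: X) :&: (B :|: X)).
  by apply: mrank_mono; rewrite subsetI !subsetUr.
have := mrank_mono M (subsetUl (A :|: X) (B :|: X)); lia.
Qed.

Definition contraction : matroid T :=
  Matroid contraction_rank_ground contraction_rank_card contraction_rank_mono
          contraction_rank_submod.

End Minors.

Definition minor (T : finType) (N M : matroid T) : Prop :=
  exists X Y : {set T},
    [/\ X \subset ground M, Y \subset ground M, [disjoint X & Y]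
      & N = contraction (deletion M Y) X].

(* |D| - 2 is an integer subtraction, hence the additive form. *)
Definition double_circuit (T : finType) (M : matroid T) (D : {set T}) : Prop :=
  [/\ D \subset ground M, mrank M D + 2 = #|D|
    & forall d, d \in D -> mrank M (D :\ d) + 2 = #|D|].

(* [partition P D] also says that the classes are nonempty; such a P is unique
   for a given D, and #|P| is the degree of D. *)
Definition circuit_partition (T : finType) (M : matroid T) (D : {set T})
    (P : {set {set T}}) : Prop :=
  partition P D /\
  forall C : {set T},
    circuit M C /\ C \subset D <-> exists2 B, B \in P & C = D :\: B.

Definition singular_classes (T : finType) (P : {set {set T}}) : {set {set T}} :=
  [set B in P | #|B| == 1].

(* A signed set is the pair of its positive and negative parts. *)
Definition signed_set (T : finType) : finType := ({set T} * {set T})%type.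

Definition supp (T : finType) (X : signed_set T) : {set T} := X.1 :|: X.2.

Definition sopp (T : finType) (X : signed_set T) : signed_set T := (X.2, X.1).

Record oriented_matroid (T : finType) : Type := OrientedMatroid {
  oground : {set T};
  scircuits : {set signed_set T};
  scircuit_ground : forall X, X \in scircuits -> supp X \subset oground;
  scircuit_disjoint : forall X, X \in scircuits -> [disjoint X.1 & X.2];
  scircuit_neq0 : forall X, X \in scircuits -> supp X != set0;
  scircuit_opp : forall X, X \in scircuits -> sopp X \in scircuits;
  scircuit_incomparable : forall X Y, X \in scircuits -> Y \in scircuits ->
    supp X \subset supp Y -> X = Y \/ X = sopp Y;
  scircuit_elim : forall X Y e, X \in scircuits -> Y \in scircuits ->
    X <> sopp Y -> e \in X.1 :&: Y.2 ->
    exists Z, [/\ Z \in scircuits, Z.1 \subset (X.1 :|: Y.1) :\ e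
                & Z.2 \subset (X.2 :|: Y.2) :\ e]
}.

(* M is the underlying matroid of O: its circuits are the supports of the signed
   circuits of O. *)
Definition orientation (T : finType) (M : matroid T) (O : oriented_matroid T) :
    Prop :=
  oground O = ground M /\
  forall A : {set T},
    circuit M A <-> exists2 X, X \in scircuits O & supp X = A.

Definition orientable (T : finType) (M : matroid T) : Prop :=
  exists O : oriented_matroid T, orientation M O.

Definition delete_scircuits (T : finType) (Y : {set T})
    (CC : {set signed_set T}) : {set signed_set T} :=
  [set C in CC | [disjoint supp C & Y]].

Definition sdiff (T : finType) (X : {set T}) (C : signed_set T) : signed_set T :=
  (C.1 :\: X, C.2 :\: X).

(* The restrictions C \ X of signed circuits C whose support is minimal among the
   nonempty ones. *)
Definition contract_scircuits (T : finType) (X : {set T})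
    (CC : {set signed_set T}) : {set signed_set T} :=
  [set S in sdiff X @: CC |
    minset (fun A => (A != set0) && (A \in [set supp (sdiff X C) | C in CC]))
           (supp S)].

Definition ominor (T : finType) (O' O : oriented_matroid T) : Prop :=
  exists X Y : {set T},
    [/\ X \subset oground O, Y \subset oground O, [disjoint X & Y],
        oground O' = (oground O :\: Y) :\: X
      & scircuits O' = contract_scircuits X (delete_scircuits Y (scircuits O))].

Definition signed_vector (T : finType) (C : signed_set T) : {ffun T -> int} :=
  [ffun e => if e \in C.1 then 1%R else if e \in C.2 then (-1)%R else 0%R].

Definition flow (T : finType) (O : oriented_matroid T) (f : {ffun T -> int}) :
    Prop :=
  exists a : signed_set T -> int,
    f = (\sum_(C in scircuits O) signed_vector C *~ a C)%R.

(* N is the underlying matroid of O', so that [cosimple N] reads: O' is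
   cosimple. *)
Definition coGSP (T : finType) (O : oriented_matroid T) : Prop :=
  forall (O' : oriented_matroid T) (N : matroid T),
    ominor O' O -> orientation N O' -> cosimple N -> oground O' != set0 ->
    exists f : {ffun T -> int},
      [/\ flow O' f, f <> 0%R,
          forall e, f e \in [:: 0%R; 1%R; (-1)%R]
        & #|[set e | f e != 0%R]| <= 2].

Definition matroid_class : Type := forall T : finType, matroid T -> Prop.

Definition minor_closed (C : matroid_class) : Prop :=
  forall (T : finType) (M N : matroid T), C T M -> minor N M -> C T N.

(* Main.v *)
(* The signed circuits contained in a double circuit D of degree k form a rank 2
   configuration: up to reorientation and signs, the classes can be ordered as
   D_0, ..., D_(k-1) so that the circuit with support D minus D_n has sign + on
   the classes after D_n and sign - on those before it.  Writing y_n for the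
   signed indicator vector of D_n, the differences of consecutive circuits show
   that y_n + y_(n+1) is a flow, hence so is y_0 - (-1)^n y_n; and the circuit
   missing D_0 is y_1 + ... + y_(k-1), so that y_0 itself is a flow when k is
   even.  If D_0 is singular, y_0 has one nonzero entry, and if D_0 and D_n are
   singular, y_0 - (-1)^n y_n has two. *)
Require Import Defs.
From mathcomp Require Import all_boot all_order all_algebra.
From mathcomp Require Import zify.

Set Implicit Arguments.
Unset Strict Implicit.
Unset Printing Implicit Defensive.

(** * Rank, circuits and bases of a matroid *)

Section Circuits.
Variables (T : finType) (M : matroid T).
Implicit Types A B C I : {set T}.
Local Notation E := (ground M).
Local Notation r := (mrank M).

Lemma mrank_setD A B : A \subset B -> r B <= r A + #|B :\: A|.
Proof. by move=> sAB; rewrite -{1}(setID B A) (setIidPr sAB) mrankU_card. Qed.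

Lemma dependentS A B :
  A \subset B -> B \subset E -> dependent M A -> dependent M B.
Proof.
move=> sAB sBE /andP[_ rA]; rewrite /dependent sBE /=.
have := mrank_setD sAB; rewrite cardsDS //.
by have := subset_leq_card sAB; lia.
Qed.

Lemma dependent_circuit A :
  dependent M A -> exists2 C, circuit M C & C \subset A.
Proof. by case/minset_exists=> C cC sCA; exists C. Qed.

(** By minimality [C :\ e] is independent, so it has the same rank as [C]. Submodularity for
    [A :\ e] and [C], whose union is [A] and whose intersection is [C :\ e], then shows that
    deleting [e] costs no rank. *)
Lemma mrank_circuitD1 A C e :
  circuit M C -> e \in C -> C \subset A -> r (A :\ e) = r A.
Proof.
move=> cC eC sCA; have [/andP[sCE rC] minC] := minsetP cC.
have rCe : #|C :\ e| <= r (C :\ e).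
  rewrite leqNgt; apply/negP=> ltr.
  have /setP/(_ e) : C :\ e = C.
    by apply: minC; rewrite ?subD1set // /dependent (subset_trans (subD1set _ _)).
  by rewrite !inE eqxx eC.
have := mrank_submod M (A :\ e) C; have := mrank_mono M (subD1set A e).
have -> : (A :\ e) :|: C = A.
  apply/setP=> x; rewrite !inE; have := subsetP sCA x.
  case: (x =P e) => [->|_]; first by rewrite eC => ->.
  by case: (x \in C) => [->|_] //; rewrite orbF.
have -> : (A :\ e) :&: C = C :\ e.
  apply/setP=> x; rewrite !inE; have := subsetP sCA x.
  by case: (x \in C) => [->|_]; rewrite ?andbT ?andbF.
by have := cardsD1 e C; rewrite eC; lia.
Qed.

(** As long as [A] is dependent, an element of one of its circuits can be deleted without loss of
    rank; the induction is on a bound for the size of [A]. *)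
Lemma basis_exists A :
  A \subset E -> exists I, [/\ I \subset A, r I = #|I| & r A = #|I|].
Proof.
move: {2}#|A| (leqnn #|A|) => n; elim: n A => [|n IHn] A leAn sAE.
  by exists set0; move: leAn; rewrite leqn0 cards_eq0 => /eqP->; rewrite mrank0 cards0.
case: (ltnP (r A) #|A|) => [ltA|geA]; last first.
  by have := mrank_card M A; exists A; split=> //; lia.
have [|C cC sCA] := @dependent_circuit A; first by rewrite /dependent sAE.
have [/andP[_ rC] _] := minsetP cC.
have /card_gt0P[e eC] : 0 < #|C| by lia.
have := cardsD1 e A; rewrite (subsetP sCA) // => cardA.
have [||I [sI rI rA]] := IHn (A :\ e); first by lia.
  exact: subset_trans (subD1set _ _) sAE.
exists I; split=> //; first exact: subset_trans sI (subD1set _ _).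
by rewrite -rA (mrank_circuitD1 cC).
Qed.

End Circuits.

(** A basis of [A] in [M] contains no circuit of [M], hence none of [N], so it stays independent in
    [N] and bounds the rank of [A] there from below. *)
Lemma mrank_le_circuits (T : finType) (M N : matroid T) (A : {set T}) :
  ground M = ground N -> (forall C, circuit N C -> circuit M C) ->
  mrank M A <= mrank N A.
Proof.
move=> eqE sNM; rewrite -(mrank_ground M) -(mrank_ground N) -eqE.
have [I [sI rI ->]] := basis_exists (subsetIr A (ground M)).
apply: leq_trans (mrank_mono N sI).
rewrite leqNgt; apply/negP=> ltI.
have sIE : I \subset ground M by apply: subset_trans sI (subsetIr _ _).
have [|C cC sCI] := @dependent_circuit _ N I.
  by rewrite /dependent -eqE sIE.
have /(dependentS sCI sIE) : dependent M C by apply/minsetp/sNM.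
by rewrite /dependent rI ltnn andbF.
Qed.

Lemma mrank_eq_circuits (T : finType) (M N : matroid T) :
  ground M = ground N -> circuit M =1 circuit N -> mrank M =1 mrank N.
Proof.
move=> eqE eqC A; apply/eqP; rewrite eqn_leq.
by rewrite !mrank_le_circuits // => C; rewrite eqC.
Qed.

(** Two matroids underlying the same oriented matroid are only known to share ground set and
    circuits. These determine the rank function, hence the dual rank, which is enough to carry
    cosimplicity over. *)
Lemma cosimple_eq_circuits (T : finType) (M N : matroid T) :
  ground M = ground N -> circuit M =1 circuit N -> cosimple M -> cosimple N.
Proof.
move=> eqE eqC csM C cC; apply: csM; move: cC; apply: etrans; apply/esym/minset_eq=> A.
by rewrite /dependent /= /dual_rank -eqE !(mrank_eq_circuits eqE eqC).
Qed.

(** * Circuits of deletions and contractions *)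

Section MinorCircuits.
Variables (T : finType) (M : matroid T) (X : {set T}).
Implicit Types A B C : {set T}.
Local Notation E := (ground M).
Local Notation r := (mrank M).

Lemma circuit_deletion C :
  circuit (deletion M X) C = circuit M C && [disjoint C & X].
Proof.
have depE A : dependent (deletion M X) A = dependent M A && [disjoint A & X].
  rewrite /dependent /= /deletion_rank subsetD.
  case: (boolP [disjoint A & X]) => [dAX|]; last by rewrite !andbF.
  by rewrite !andbT (setDidPl dAX).
apply/minsetP/andP=> [[]|[/minsetP[depC minC] dCX]].
  rewrite depE => /andP[depC dCX] minC; split=> //; apply/minsetP; split=> // B depB sBC.
  by apply: minC; rewrite // depE depB (disjointWl sBC).
rewrite depE depC dCX; split=> // B; rewrite depE => /andP[depB _].
exact: minC.
Qed.

Hypothesis sXE : X \subset E.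

Lemma dependent_contraction A :
  dependent (contraction M X) A <->
  A \subset E :\: X /\
    exists C, [/\ circuit M C, C :\: X != set0 & C :\: X \subset A].
Proof.
rewrite /dependent /= /contraction_rank; split.
  case/andP=> sA; have := mrank_mono M (subsetUr A X) => le_r lt_r; split=> //.
  move: sA; rewrite subsetD => /andP[sAE dAX].
  (* Replacing [X] by a basis [I] gives r(I ∪ A) ≤ r(A ∪ X) < |I| + |A|, so I ∪ A contains a
     circuit. If this circuit lay in [X], it would lie in the independent set [I]. *)
  have [I [sIX rI rX]] := basis_exists sXE.
  have dIA : I :&: A = set0.
    apply/eqP; rewrite setI_eq0; exact: disjointWl sIX (etrans (disjoint_sym _ _) dAX).
  have [|C cC sC] := @dependent_circuit _ M (I :|: A).
    rewrite /dependent subUset (subset_trans sIX sXE) sAE /=.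
    have : r (I :|: A) <= r (A :|: X).
      by apply: mrank_mono; rewrite setUC setUS.
    by rewrite cardsU dIA cards0; lia.
  exists C; split=> //; last first.
    rewrite subDset; apply: subset_trans sC _; exact: setSU.
  apply/negP; rewrite setD_eq0 => sCX.
  have sCI : C \subset I.
    apply/subsetP=> x xC; have := subsetP sC x xC; rewrite inE => /orP[//|xA].
    by move/(subsetP sCX): xC => xX; move: (disjointFr dAX xA); rewrite xX.
  have := dependentS sCI (subset_trans sIX sXE) (minsetp cC).
  by rewrite /dependent rI ltnn andbF.
case=> sA [C [cC /set0Pn[e]]]; rewrite inE => /andP[eX eC] sCA.
rewrite sA /=.
(* Conversely, an element [e] of [C] outside [X] can be removed from A ∪ X without loss of rank, so
   r(A ∪ X) - r(X) is at most |A| - 1. *)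
have sCXA : C \subset A :|: X.
  by rewrite setUC -subDset.
have := mrank_circuitD1 cC eC sCXA.
have eA : e \in A by apply: (subsetP sCA); rewrite inE eX.
have sX : X \subset (A :|: X) :\ e.
  by apply/subsetP=> x xX; rewrite !inE xX orbT andbT; apply: contraNneq eX => <-.
have := mrank_setD M sX.
have sD : ((A :|: X) :\ e) :\: X \subset A :\ e.
  by apply/subsetP=> x; rewrite !inE; case: (x \in X); rewrite ?orbF.
have := subset_leq_card sD; have := cardsD1 e A; rewrite eA.
have := mrank_mono M (subsetUr A X); lia.
Qed.

(** Every nonempty [C :\: X] is dependent in the contraction, and every dependent set contains one,
    so both families have the same minimal members. The right-hand side has the shape of the
    minimality condition in [contract_scircuits]. *)
Lemma circuit_contraction A :
  circuit (contraction M X) A =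
  minset (fun B => (B != set0) && (B \in [set C :\: X | C in circuit M])) A.
Proof.
have Qdep B : (B != set0) && (B \in [set C :\: X | C in circuit M]) ->
    dependent (contraction M X) B.
  case/andP=> B0 /imsetP[C cC defB]; apply/dependent_contraction; split.
    by rewrite defB; apply: setSD; case/andP: (minsetp cC).
  by exists C; rewrite -defB.
have depQ B : dependent (contraction M X) B -> exists2 B' : {set T},
    (B' != set0) && (B' \in [set C :\: X | C in circuit M]) & B' \subset B.
  move=> /dependent_contraction[_ [C [cC C0 sC]]].
  by exists (C :\: X); rewrite // C0; apply/imsetP; exists C.
apply/minsetP/minsetP=> -[PA minA]; split.
- have [B QB sBA] := depQ _ PA.
  by rewrite -(minA B) // Qdep.
- by move=> B QB sBA; apply: minA => //; apply: Qdep.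
- exact: Qdep.
- move=> B depB sBA; have [B' QB' sB'B] := depQ _ depB.
  apply/eqP; rewrite eqEsubset sBA -{1}(minA B') //.
  exact: subset_trans sB'B sBA.
Qed.

End MinorCircuits.

(** * Underlying matroids of oriented minors *)

Lemma supp_sdiff (T : finType) (X : {set T}) (S : signed_set T) :
  supp (sdiff X S) = supp S :\: X.
Proof. by rewrite /supp /sdiff /= setDUl. Qed.

(** Taking supports commutes with deleting and restricting signed circuits, so the same [X] and [Y]
    define the matroid minor, and the two minimality conditions are about the same family of
    sets. *)
Lemma orientation_ominor (T : finType) (M : matroid T) (O O' : oriented_matroid T) :
  orientation M O -> ominor O' O ->
  exists2 N : matroid T, minor N M & orientation N O'.
Proof.
move=> [gO cO] [X [Y [sX sY dXY gO' cO']]]; rewrite gO in sX sY gO'.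
exists (contraction (deletion M Y) X); first by exists X, Y.
have sXD : X \subset ground (deletion M Y) by rewrite subsetD sX.
split=> // A; rewrite circuit_contraction // cO' /contract_scircuits.
set CC := delete_scircuits _ _.
have eqQ : (fun B : {set T} => (B != set0) &&
    (B \in [set C :\: X | C in circuit (deletion M Y)])) =1
  (fun B => (B != set0) && (B \in [set supp (sdiff X C) | C in CC])).
  move=> B; congr (_ && _); apply/imsetP/imsetP=> [[C]|[S]].
    rewrite -topredE /= circuit_deletion => /andP[/cO[S SO <-] dSY] ->.
    by exists S; rewrite ?supp_sdiff // inE SO.
  rewrite inE => /andP[SO dSY] ->; exists (supp S); last exact: supp_sdiff.
  by rewrite -topredE /= circuit_deletion dSY andbT; apply/cO; exists S.
rewrite (minset_eq _ eqQ); split=> [minA|[S]].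
  have /andP[_ /imsetP[S SCC defA]] := minsetp minA.
  exists (sdiff X S); last by rewrite defA.
  by rewrite inE imset_f //= -defA.
by rewrite inE => /andP[_ minS] <-.
Qed.

Import GRing.Theory.
Local Open Scope ring_scope.

(** * Signed vectors, circuit elimination and flows *)

Section SignedVectors.
Variables (T : finType) (O : oriented_matroid T).
Implicit Types (X Y Z : signed_set T) (f g : {ffun T -> int}) (e x : T).

Lemma signed_vector_mem X x : signed_vector X x \in [:: 0; 1; -1].
Proof. by rewrite ffunE; case: ifP => // _; case: ifP. Qed.

Lemma signed_vector_eq0 X x : (signed_vector X x == 0) = (x \notin supp X).
Proof. by rewrite ffunE inE; case: (x \in X.1); case: (x \in X.2). Qed.

Lemma signed_vector_sopp X x :
  [disjoint X.1 & X.2] -> signed_vector (sopp X) x = - signed_vector X x.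
Proof.
move=> dX; rewrite !ffunE /=; case: (boolP (x \in X.1)) => [x1|_].
  by rewrite (disjointFr dX x1).
by case: ifP; rewrite ?opprK ?oppr0.
Qed.

Lemma signed_vector_eq1 X x : (signed_vector X x == 1) = (x \in X.1).
Proof. by rewrite ffunE; case: (x \in X.1); case: (x \in X.2). Qed.

Lemma signed_vector_eqN1 X x :
  [disjoint X.1 & X.2] -> (signed_vector X x == -1) = (x \in X.2).
Proof.
move=> dX; rewrite ffunE; case: (boolP (x \in X.1)) => [x1|_].
  by rewrite (disjointFr dX x1).
by case: ifP.
Qed.

(** Circuit elimination in terms of values instead of positive and negative parts, so that it can be
    used without knowing which of the two circuits is positive at [e]. *)
Lemma signed_vector_elim X Y e :
  X \in scircuits O -> Y \in scircuits O -> X <> sopp Y ->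
  signed_vector X e != 0 -> signed_vector X e = - signed_vector Y e ->
  exists Z, [/\ Z \in scircuits O, signed_vector Z e = 0
    & forall x, x \in supp Z -> signed_vector Z x = signed_vector X x \/
                                signed_vector Z x = signed_vector Y x].
Proof.
(* The values at [e] are opposite and the conclusion is symmetric, so [X] and [Y] may be
   exchanged. *)
wlog Xe : X Y / signed_vector X e = 1 => [IH|].
  move=> XO YO neq nz0 eqXY; have := signed_vector_mem X e.
  rewrite !inE (negPf nz0) /= => /orP[/eqP Xe|/eqP Xe]; first exact: IH.
  have [] := IH Y X => //.
  - by apply: oppr_inj; rewrite -eqXY Xe.
  - by move=> defY; case: neq; rewrite defY; case: (X).
  - by apply: contraNneq nz0 => Y0; rewrite eqXY Y0.
  - by rewrite eqXY opprK.
  move=> Z [ZO Ze sgnZ]; exists Z; split=> // x /sgnZ[]; by [right | left].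
move=> XO YO neq _; rewrite Xe => /esym/eqP; rewrite eqr_oppLR => /eqP Ye.
have [dX dY] := (scircuit_disjoint XO, scircuit_disjoint YO).
have eXY : e \in X.1 :&: Y.2.
  by rewrite inE -signed_vector_eq1 -signed_vector_eqN1 // Xe Ye.
have [Z [ZO sZ1 sZ2]] := scircuit_elim XO YO neq eXY.
have dZ := scircuit_disjoint ZO.
exists Z; split=> // [|x].
  apply/eqP; rewrite signed_vector_eq0 inE; apply/norP; split; apply/negP.
    by move/(subsetP sZ1); rewrite !inE eqxx.
  by move/(subsetP sZ2); rewrite !inE eqxx.
rewrite inE => /orP[xZ|xZ].
  have /eqP-> : signed_vector Z x == 1 by rewrite signed_vector_eq1.
  have := subsetP sZ1 x xZ; rewrite !inE -!signed_vector_eq1.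
  by case/andP=> _ /orP[]/eqP->; by [left | right].
have /eqP-> : signed_vector Z x == -1 by rewrite signed_vector_eqN1.
have := subsetP sZ2 x xZ; rewrite !inE -!signed_vector_eqN1 //.
by case/andP=> _ /orP[]/eqP->; by [left | right].
Qed.

Lemma flow_scircuit X : X \in scircuits O -> flow O (signed_vector X).
Proof.
move=> XO; exists (fun Y => (Y == X)%:Z).
rewrite (bigD1 X) //= eqxx mulr1z big1 ?addr0 // => Y /andP[_ /negPf->].
by rewrite mulr0z.
Qed.

Lemma flowD f g : flow O f -> flow O g -> flow O (f + g).
Proof.
move=> [a ->] [b ->]; exists (fun Y => a Y + b Y).
by rewrite -big_split; apply: eq_bigr => Y _; rewrite mulrzDr.
Qed.

Lemma flowN f : flow O f -> flow O (- f).
Proof.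
move=> [a ->]; exists (fun Y => - a Y).
by rewrite -sumrN; apply: eq_bigr => Y _; rewrite mulrNz.
Qed.

Lemma flow0 : flow O 0.
Proof. by exists (fun=> 0); rewrite big1 // => Y _; rewrite mulr0z. Qed.

End SignedVectors.

(** * Ordering the classes of a double circuit *)

Section DoubleCircuit.
Variables (T : finType) (O : oriented_matroid T) (D : {set T}) (P : {set {set T}}).
Hypothesis partP : partition P D.
Hypothesis circP : forall A : {set T},
  (exists2 X, X \in scircuits O & supp X = A) /\ A \subset D <->
  exists2 B, B \in P & A = D :\: B.

(* The sequence p lists the classes in order, h is the reorientation, and
   [set e0], having index 0, comes first. *)
Lemma double_circuit_order (e0 : T) : [set e0] \in P ->
  exists (p : seq {set T}) (h : T -> int),
  [/\ perm_eq p (enum P), index [set e0] p = 0%N,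
      {in D, forall g, h g = 1 \/ h g = -1}
    & {in P, forall B, exists2 X, X \in scircuits O
        & forall g, signed_vector X g =
            if g \in D then
              h g * ((index B p < index (pblock P g) p)%N%:Z
                     - (index (pblock P g) p < index B p)%N%:Z)
            else 0}].
Proof.
move=> e0P; have [covP trivP P0] := and3P partP.
have sPD B : B \in P -> B \subset D.
  by move=> BP; rewrite -(eqP covP) (bigcup_max B).
have pbP g B : B \in P -> g \in B -> pblock P g = B by move=> *; apply: def_pblock.
have pb_mem g : g \in D -> pblock P g \in P /\ g \in pblock P g.
  by rewrite -(eqP covP) => gP; rewrite pblock_mem ?mem_pblock.
have e0D : e0 \in D by apply: (subsetP (sPD _ e0P)); rewrite inE.
have pb_e0 g : g \in D -> (pblock P g == [set e0]) = (g == e0).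
  move=> gD; apply/eqP/eqP=> [eqg|->]; last by apply: pbP; rewrite // inE.
  by apply/set1P; rewrite -eqg; case: (pb_mem g gD).
have [X0 X0O suppX0] : exists2 X, X \in scircuits O & supp X = D :\ e0.
  by have [|] := (circP (D :\ e0)).2; first by exists [set e0].
set v0 := signed_vector X0.
have v0_sgn g : g \in D -> g != e0 -> v0 g = 1 \/ v0 g = -1.
  move=> gD ge0; have := signed_vector_mem X0 g.
  rewrite !inE signed_vector_eq0 suppX0 !inE ge0 gD /=.
  by case/orP=> /eqP; [left | right].
have v0_sq g : g \in D -> g != e0 -> v0 g * v0 g = 1.
  by move=> gD ge0; case: (v0_sgn g gD ge0) => ->.
pose Q := P :\ [set e0].
have QP B : B \in Q -> B \in P by case/setD1P.
have e0Q B : B \in Q -> e0 \notin B.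
  move=> BQ; apply/negP=> e0B; have eqB := pbP e0 B (QP B BQ) e0B.
  by move: BQ; rewrite !inE -eqB pb_e0 ?eqxx.
have Q_ne B : B \in Q -> exists g, g \in B.
  by move=> /QP BP; apply/set0Pn; apply: contraNneq P0 => <-.
(* The sign at [e0] is normalised to -1 because [[set e0]] will come before every class in [Q].
   Outside [Q] the value [X0] is a mere default. *)
have /fin_all_exists[Xc XcP] : forall B : {set T}, exists X, B \in Q ->
    [/\ X \in scircuits O, supp X = D :\: B & signed_vector X e0 = -1].
  move=> B; case: (boolP (B \in Q)) => [BQ|]; last by exists X0.
  have [|[X XO suppX] _] := (circP (D :\: B)).2; first by exists B; rewrite ?QP.
  have := signed_vector_mem X e0.
  rewrite !inE signed_vector_eq0 suppX !inE e0D e0Q //=.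
  case/orP=> /eqP Xe; last by exists X.
  exists (sopp X) => _; rewrite scircuit_opp // signed_vector_sopp ?Xe.
    by split=> //; rewrite /supp setUC.
  exact: scircuit_disjoint XO.
(* This is the sign of [Xc B] after the reorientation that makes [X0] positive everywhere on its
   support. *)
pose w (B : {set T}) (g : T) : int := signed_vector (Xc B) g * v0 g.
have w0 B g : B \in Q -> g \in B -> w B g = 0.
  move=> BQ gB; have [_ sX _] := XcP B BQ.
  by apply/eqP; rewrite mulf_eq0 signed_vector_eq0 sX inE gB.
have wE B g : g \in D -> g != e0 -> signed_vector (Xc B) g = w B g * v0 g.
  by move=> gD ge0; rewrite /w -mulrA v0_sq ?mulr1.
(* Eliminating e0 between Xc A and the opposite of Xc B yields X0 or its
   opposite; this single elimination gives both the tournament on Q and its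
   transitivity. *)
have elim_e0 A B : A \in Q -> B \in Q -> A != B ->
    exists2 t : int, t = 1 \/ t = -1 &
      forall g, g \in D -> g != e0 -> w A g = t \/ w B g = - t.
  move=> AQ BQ neqAB; have [AO sA Ae] := XcP A AQ; have [BO sB Be] := XcP B BQ.
  have dB := scircuit_disjoint BO.
  have [|||||Z [ZO Ze sgnZ]] := @signed_vector_elim _ O (Xc A) (sopp (Xc B)) e0 => //.
  - exact: scircuit_opp.
  - move=> eqAB; case/eqP: neqAB.
    have eqD : D :\: A = D :\: B by rewrite -sA -sB eqAB; case: (Xc B).
    have DD C : C \in Q -> D :\: (D :\: C) = C.
      by move=> CQ; rewrite setDDr setDv set0U; apply/setIidPr/sPD/QP.
    by rewrite -(DD A) // eqD DD.
  - by rewrite Ae.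
  - by rewrite signed_vector_sopp // Ae Be.
  have sZD : supp Z \subset D.
    apply/subsetP=> x xZ; have := xZ; rewrite -[x \in _]negbK -signed_vector_eq0.
    case: (sgnZ x xZ) => ->; rewrite ?signed_vector_sopp ?oppr_eq0 //.
      by rewrite signed_vector_eq0 sA negbK inE => /andP[].
    by rewrite signed_vector_eq0 sB negbK inE => /andP[].
  (* The class missed by [Z] contains [e0], so it is [[set e0]], and incomparability leaves only
     [X0] and its opposite. *)
  have [|C CP suppZ] := (circP (supp Z)).1; first by split=> //; exists Z.
  have e0C : e0 \in C.
    by move/eqP: Ze; rewrite signed_vector_eq0 suppZ inE e0D andbT negbK.
  have defC : C = [set e0] by rewrite -(pbP e0 C) //; apply/eqP; rewrite pb_e0.
  have [t tP Zv0] : exists2 t : int, t = 1 \/ t = -1 &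
      forall g, signed_vector Z g = t * v0 g.
    have [|||->|->] := @scircuit_incomparable _ O Z X0 => //.
    - by rewrite suppZ suppX0 defC.
    - by exists 1 => [|g]; [left | rewrite mul1r].
    exists (-1) => [|g]; first by right.
    by rewrite signed_vector_sopp ?mulN1r //; apply: scircuit_disjoint X0O.
  exists t => // g gD ge0.
  have gZ : g \in supp Z by rewrite suppZ defC !inE ge0.
  have := sgnZ g gZ; rewrite Zv0 signed_vector_sopp // /w => -[vA|vB]; [left | right].
    by rewrite -vA -mulrA v0_sq ?mulr1.
  by apply: oppr_inj; rewrite -mulNr -vB -mulrA v0_sq ?mulr1 ?opprK.
have tournament A B : A \in Q -> B \in Q -> A != B ->
    exists2 t : int, t = 1 \/ t = -1 &
    [/\ {in B, forall g, w A g = t}, {in A, forall g, w B g = - t}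
      & forall g, g \in D -> g != e0 -> w A g = t \/ w B g = - t].
  move=> AQ BQ neqAB; have [t tP tw] := elim_e0 A B AQ BQ neqAB.
  (* On the class missed by its own circuit [w] is 0, which is neither [t] nor [- t], so there the
     other alternative of [tw] must hold. *)
  exists t => //; split=> // g gX; have [|||] := tw g.
  - exact: (subsetP (sPD B (QP _ BQ))).
  - by apply: contraTneq gX => ->; apply: e0Q.
  - by [].
  - by rewrite w0 //; case: tP => ->.
  - exact: (subsetP (sPD A (QP _ AQ))).
  - by apply: contraTneq gX => ->; apply: e0Q.
  - by rewrite w0 //; case: tP => ->.
  - by [].
(* A class precedes those on which its circuit is positive; the equality disjunct makes the relation
   reflexive, as totality requires. *)
pose le (A B : {set T}) := (A == B) || [forall g in B, w A g == 1].
have le_lt A B : A \in Q -> B \in Q -> A != B -> le A B ->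
    [/\ {in B, forall g, w A g = 1}, {in A, forall g, w B g = - 1}
      & forall g, g \in D -> g != e0 -> w A g = 1 \/ w B g = -1].
  move=> AQ BQ neqAB; rewrite /le (negPf neqAB) /= => /forall_inP le_AB.
  have [t _ [tAB tBA tg]] := tournament A B AQ BQ neqAB.
  have [g gB] := Q_ne B BQ; have t1 : t = 1 by rewrite -(tAB g gB); apply/eqP/le_AB.
  by rewrite -t1.
have le_total : {in Q &, total le}.
  move=> A B AQ BQ; rewrite /le; case: eqVneq => //= neqAB.
  have [t [] -> [tAB tBA _]] := tournament A B AQ BQ neqAB.
    by apply/orP; left; apply/forall_inP=> g /tAB->.
  by apply/orP; right; apply/forall_inP=> g /tBA->.
have le_trans : {in Q & &, transitive le}.
  move=> B A C BQ AQ CQ; have [->//|neqAB] := eqVneq A B.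
  have [->//|neqBC] := eqVneq B C => leAB leBC.
  have [_ _ lt1] := le_lt A B AQ BQ neqAB leAB.
  have [lt2 _ _] := le_lt B C BQ CQ neqBC leBC.
  (* On [C], the comparison of [A] with [B] gives [w A g = 1] or [w B g = -1], and the second is
     excluded since [B] precedes [C]. *)
  apply/orP; right; apply/forall_inP=> g gC; have [||->//|] := lt1 g.
  - exact: (subsetP (sPD C (QP _ CQ))).
  - by apply: contraTneq gC => ->; apply: e0Q.
  by rewrite lt2.
pose q := sort le (enum Q); pose p := [set e0] :: q.
have memq B : (B \in q) = (B \in Q) by rewrite mem_sort mem_enum.
have le_index : {in Q &, forall A B, (index A q < index B q)%N -> le A B}.
  move=> A B AQ BQ; apply: (@sorted_ltn_index_in _ le q); rewrite ?memq //.
    by move=> x y z; rewrite !memq; apply: le_trans.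
  by apply: (@sort_sorted_in _ (mem Q)) => //; apply/allP=> x; rewrite mem_enum.
have indexE B : B \in Q -> index B p = (index B q).+1.
  by rewrite !inE /= eq_sym => /andP[/negPf->].
have index0 : index [set e0] p = 0%N by rewrite /= eqxx.
(* At [e0], where [v0] vanishes, the value 1 agrees with the normalisation of the circuits
   [Xc B]. *)
exists p, (fun g => if g == e0 then 1 else v0 g); split=> //.
- apply: uniq_perm; rewrite ?enum_uniq //= ?sort_uniq ?enum_uniq ?memq ?inE ?eqxx //.
  by move=> B; rewrite mem_enum !inE memq !inE; case: eqP => [->|].
- move=> g gD; case: (eqVneq g e0) => [_|]; first by left.
  exact: v0_sgn.
move=> B BP; have pbQ g : g \in D -> g != e0 -> pblock P g \in Q.
  by move=> gD ge0; rewrite !inE pb_e0 // ge0; case: (pb_mem g gD).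
case: (eqVneq B [set e0]) => [->|nB].
  exists X0 => // g; rewrite index0.
  case: (boolP (g \in D)) => gD; last first.
    by apply/eqP; rewrite signed_vector_eq0 suppX0 inE negb_and gD orbT.
  case: eqP => [->|/eqP ge0].
    have /eqP-> : pblock P e0 == [set e0] by rewrite pb_e0.
    by rewrite index0; apply/eqP; rewrite signed_vector_eq0 suppX0 !inE eqxx.
  by rewrite indexE ?pbQ //= subr0 mulr1.
have BQ : B \in Q by rewrite !inE nB.
have [BO sB Be] := XcP B BQ; exists (Xc B) => // g.
case: (boolP (g \in D)) => gD; last first.
  by apply/eqP; rewrite signed_vector_eq0 sB inE negb_and gD orbT.
case: eqP => [->|/eqP ge0].
  have /eqP-> : pblock P e0 == [set e0] by rewrite pb_e0.
  by rewrite Be index0 indexE.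
have AQ := pbQ g gD ge0; have [_] := pb_mem g gD; rewrite !indexE // !ltnS wE //.
move: (pblock P g) AQ => A AQ gA; case: (eqVneq A B) => [eqAB|neqAB].
  by rewrite eqAB ltnn w0 ?mul0r ?mulr0 // -eqAB.
case: (ltngtP (index B q) (index A q)) => [ltBA|ltAB|eqi].
- have [|-> //] := le_lt B A BQ AQ _ (le_index _ _ BQ AQ ltBA); first by rewrite eq_sym.
  by rewrite mul1r subr0 mulr1.
- have [// |_ -> // _] := le_lt A B AQ BQ _ (le_index _ _ AQ BQ ltAB).
  by rewrite mulN1r sub0r mulrN1.
have BqB : B \in q by rewrite memq.
by case/eqP: neqAB; rewrite -(nth_index B BqB) eqi nth_index ?memq.
Qed.

End DoubleCircuit.

(** * Small flows from the ordered classes *)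

Lemma sgn_step (n m : nat) :
  ((n < m)%N%:Z - (m < n)%N%:Z) - ((n.+1 < m)%N%:Z - (m < n.+1)%N%:Z) =
  (m == n)%:Z + (m == n.+1)%:Z.
Proof. lia. Qed.

Section DoubleCircuitFlow.
Variables (T : finType) (O : oriented_matroid T) (D : {set T}) (P : {set {set T}}).
Hypothesis partP : partition P D.
Hypothesis circP : forall A : {set T},
  (exists2 X, X \in scircuits O & supp X = A) /\ A \subset D <->
  exists2 B, B \in P & A = D :\: B.

Lemma double_circuit_class_flows (e0 : T) : [set e0] \in P ->
  exists (i : {set T} -> nat) (h : T -> int) (y : {set T} -> {ffun T -> int}),
  [/\ {in D, forall g, h g = 1 \/ h g = -1},
      {in P, forall B g, y B g = if g \in B then h g else 0},
      {in P, forall B, flow O (if odd (i B) then y [set e0] + y B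
                                            else y [set e0] - y B)}
    & ~~ odd #|P| -> flow O (y [set e0])].
Proof.
move=> e0P; have [p [h [permp ind0 hD circ]]] := double_circuit_order partP circP e0P.
have [/eqP covP trivP _] := and3P partP.
have memp B : (B \in p) = (B \in P) by rewrite (perm_mem permp) mem_enum.
have sizep : size p = #|P| by rewrite (perm_size permp) -cardE.
pose i g := index (pblock P g) p.
(* Here [z n] is y_n, [s n] is y_1 + ... + y_(n-1), and [c n] is the circuit missing the class of
   index [n]. *)
pose z n : {ffun T -> int} := [ffun g => if (g \in D) && (i g == n) then h g else 0].
pose s n : {ffun T -> int} := [ffun g => if (g \in D) && (0 < i g < n)%N then h g else 0].
pose c n : {ffun T -> int} :=
  [ffun g => if g \in D then h g * ((n < i g)%N%:Z - (i g < n)%N%:Z) else 0].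
have circ_n n : (n < #|P|)%N -> flow O (c n).
  move=> ltn; have uniqp : uniq p by rewrite (perm_uniq permp) enum_uniq.
  have nP : nth set0 p n \in P by rewrite -memp mem_nth ?sizep.
  have [X XO eqX] := circ _ nP.
  suff -> : c n = signed_vector X by apply: flow_scircuit.
  by apply/ffunP=> g; rewrite [LHS]ffunE eqX index_uniq ?sizep.
(* At position m, [c n] is [h] times the sign of m - n. Passing from n to n + 1 lowers this sign by
   1 exactly at m = n and m = n + 1. *)
have z_step n : (n.+1 < #|P|)%N -> flow O (z n + z n.+1).
  move=> ltn; have := flowD (circ_n n (ltnW ltn)) (flowN (circ_n _ ltn)).
  congr (flow O _); apply/ffunP=> g; rewrite !ffunE; case: (g \in D) => //=.
  rewrite -mulrBr sgn_step mulrDr.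
  by case: (_ == n); case: (_ == n.+1); rewrite /= ?mulr0 ?mulr1.
have z0n n : (n < #|P|)%N -> flow O (if odd n then z 0 + z n else z 0 - z n).
  elim: n => [|n IHn] ltn; first by rewrite subrr; apply: flow0.
  have := IHn (ltnW ltn); have /= := z_step n ltn; case: (odd n) => /= fs f0.
    have := flowD f0 (flowN fs); congr (flow O _).
    by rewrite opprD addrA addrK.
  have := flowD f0 fs; congr (flow O _).
  by rewrite addrA subrK.
(* The sum [s n] has n - 1 terms, each congruent to [z 0] up to sign modulo flows; a leftover [z 0]
   survives exactly when n is even. *)
have s_n n : (0 < n <= #|P|)%N -> flow O (if odd n then s n else s n + z 0).
  case: n => // n /= ltn; elim: n ltn => [|n IHn] ltn.
    suff -> : s 1%N = 0 by apply: flow0.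
    apply/ffunP=> g; rewrite !ffunE; case: ifP => // /andP[_]; lia.
  have sS : s n.+2 = s n.+1 + z n.+1.
    apply/ffunP=> g; rewrite !ffunE; case: (g \in D); rewrite ?addr0 //= ltnS.
    have [->|neq] := eqVneq (i g) n.+1; first by rewrite ltnn leqnn add0r.
    by rewrite addr0 (leq_eqVlt (i g)) (negPf neq).
  have := IHn (ltnW ltn); have := z0n _ ltn; rewrite sS /=.
  case: (odd n) => /= f0 fs.
    have := flowD fs (flowN f0); congr (flow O _).
    by rewrite opprB addrACA subrr addr0.
  have := flowD fs f0; congr (flow O _).
  by rewrite [z 0 + _]addrC addrA.
exists (fun B => index B p), h, (fun B => z (index B p)); split=> //.
- move=> B BP g; rewrite ffunE; case: (boolP (g \in B)) => [gB|gB].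
    by rewrite /i (def_pblock trivP BP gB) eqxx -covP (subsetP (bigcup_sup B BP)).
  case: ifP => // /andP[gD /eqP eqi]; case/negP: gB.
  have gP : pblock P g \in P by rewrite pblock_mem ?covP.
  by rewrite -(nth_index set0 (_ : B \in p)) ?memp // -eqi nth_index ?memp // mem_pblock covP.
- by move=> B BP /=; rewrite ind0; apply: z0n; rewrite -sizep index_mem memp.
move=> evenP; rewrite ind0.
have P_gt0 : (0 < #|P|)%N by apply/card_gt0P; exists [set e0].
(* Since [s #|P|] equals the circuit [c 0], subtracting that circuit from the flow [s #|P| + z 0]
   leaves [z 0]. *)
have := s_n #|P|; rewrite P_gt0 leqnn (negPf evenP) => /(_ isT) fs.
have := flowD fs (flowN (circ_n 0%N P_gt0)); congr (flow O _).
apply/ffunP=> g; rewrite !ffunE; case: (boolP (g \in D)) => gD; rewrite /= ?subr0 ?addr0 //.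
have -> : (i g < #|P|)%N by rewrite -sizep index_mem memp pblock_mem ?covP.
by case: (i g) => [|j] /=; rewrite ?addr0 ?add0r ?subr0 ?mulr0 ?subr0 ?mulr1 ?subrr.
Qed.

Lemma double_circuit_small_flow :
  ~~ odd #|P| /\ (1 <= #|singular_classes P|)%N \/
    odd #|P| /\ (2 <= #|singular_classes P|)%N ->
  exists f : {ffun T -> int},
    [/\ flow O f, f <> 0, forall e, f e \in [:: 0; 1; -1]
      & (#|[set e | f e != 0%R]| <= 2)%N].
Proof.
have sgP B : B \in singular_classes P -> exists2 e, B = [set e] & [set e] \in P.
  by rewrite inE => /andP[BP /cards1P[e defB]]; exists e; rewrite -?defB.
have inD e : [set e] \in P -> e \in D.
  case/and3P: partP => /eqP<- _ _ eP; apply/bigcupP.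
  by exists [set e]; rewrite // inE.
case=> [[evenP /card_gt0P[B /sgP[e0 _ e0P]]]|].
  have [i [h [y [hD yE _ /(_ evenP) f0]]]] := double_circuit_class_flows e0P.
  exists (y [set e0]); split=> //.
  - move/ffunP/(_ e0); rewrite ffunE yE // inE eqxx.
    by case: (hD e0 (inD _ e0P)) => ->.
  - move=> e; rewrite yE // in_set1; case: (e =P e0) => // ->.
    by case: (hD e0 (inD _ e0P)) => ->.
  rewrite -[2%N]/(1 + 1)%N; apply: leq_trans (leq_addr _ _); rewrite -(cards1 e0).
  apply/subset_leq_card/subsetP=> e; rewrite !inE yE // in_set1.
  by case: (e =P e0) => //; rewrite eqxx.
case=> _ /card_gt1P[B [B' [/sgP[e0 -> e0P] /sgP[e1 -> e1P] neq]]].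
have {neq} ne10 : e1 != e0 by apply: contraNneq neq => ->.
have [i [h [y [hD yE /(_ _ e1P) f01 _]]]] := double_circuit_class_flows e0P.
move: f01; set f := (if _ then _ else _) => f01.
have [h0 h1] := (hD e0 (inD _ e0P), hD e1 (inD _ e1P)).
(* As [e0] and [e1] are distinct, the two class vectors have disjoint supports and nothing cancels
   or adds up to 2. *)
have fE e : f e = (if e == e0 then h e0 else if e == e1
                   then (if odd (i [set e1]) then h e1 else - h e1) else 0).
  rewrite /f; case: (odd _); rewrite !ffunE !yE // !inE;
    case: (eqVneq e e0) => [->|_]; rewrite ?[e0 == e1]eq_sym ?(negPf ne10) ?subr0 ?addr0 //;
    by case: eqP => [->|_]; rewrite ?add0r ?sub0r ?oppr0.
exists f; split=> //.
- by move/ffunP/(_ e0); rewrite fE eqxx ffunE; case: h0 => ->.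
- move=> e; rewrite fE; case: eqP => _; first by case: h0 => ->.
  by case: eqP => // _; case: ifP => _; case: h1 => ->.
apply: leq_trans (_ : #|[set e0; e1]| <= 2)%N; last by rewrite cards2 eq_sym ne10.
apply/subset_leq_card/subsetP=> e; rewrite !inE fE.
by case: (e =P e0) => // _; case: (e =P e1).
Qed.

End DoubleCircuitFlow.

(** * The one-element case and the conclusion *)

Lemma cosimple_single_loop (T : finType) (M : matroid T) :
  cosimple M -> #|ground M| = 1%N -> circuit M (ground M).
Proof.
move=> csM E1; have /cards1P[e defE] : #|ground M| == 1%N by rewrite E1.
(* If the single element had rank 1, it would have rank 0 in the dual, giving a dual circuit with at
   most one element, against cosimplicity. *)
have r0 : mrank M (ground M) = 0%N.
  apply/eqP/negPn/negP => rn0.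
  have [|C /csM lt2C /subset_leq_card] := @dependent_circuit _ (dual M) (ground M).
    rewrite /dependent subxx /= /dual_rank setIid setDv mrank0 E1.
    by move: rn0; case: (mrank _ _).
  by rewrite E1 leqNgt => /negP[]; apply: ltn_trans lt2C.
apply/minsetP; split; first by rewrite /dependent subxx r0 E1.
move=> B /andP[_ rB] sBE; apply/eqP; rewrite eqEcard sBE E1.
exact: leq_trans rB.
Qed.

Local Close Scope ring_scope.

(* A cosimple matroid with at most one element is the empty matroid or a single
   loop; neither has a double circuit, and both are exempted from the hypothesis
   on double circuits. *)
Theorem proposition16 (C : matroid_class)
    (C_minor : minor_closed C)
    (C_orientable : forall (T : finType) (M : matroid T), C T M -> orientable M)
    (C_double_circuit : forall (T : finType) (M : matroid T),
       C T M -> cosimple M -> 1 < #|ground M| ->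
       exists (D : {set T}) (P : {set {set T}}),
         [/\ double_circuit M D, circuit_partition M D P
           & ~~ odd #|P| /\ 1 <= #|singular_classes P| \/
             odd #|P| /\ 2 <= #|singular_classes P|]) :
  forall (T : finType) (M : matroid T) (O : oriented_matroid T),
    C T M -> orientation M O -> coGSP O.
Proof.
move=> T M O CM orM O' N' minO orN' csN' nzO'.
have [N minN orN] := orientation_ominor orM minO.
(* [coGSP] speaks of any matroid [N'] underlying [O'], whereas membership in the class is known for
   the minor [N]. *)
have {csN'} csN : cosimple N.
  have [[gN cN] [gN' cN']] := (orN, orN').
  apply: cosimple_eq_circuits csN'; first by rewrite -gN -gN'.
  by move=> A; apply/idP/idP=> [/cN'/cN|/cN/cN'].
have [gN cN] := orN; rewrite gN in nzO'.
case: (ltngtP #|ground N| 1) => [|E2|E1].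
- by rewrite ltnS leqn0 cards_eq0 (negPf nzO').
- have [D [P [_ [partP circP] degP]]] := C_double_circuit T N (C_minor _ _ _ CM minN) csN E2.
  apply: (double_circuit_small_flow partP _ degP) => A.
  by rewrite -circP; split=> -[/cN].
(* A single loop is itself a circuit, and its signed vector is a flow with one nonzero entry. *)
have /cN[X XO' suppX] := cosimple_single_loop csN E1.
exists (signed_vector X); split; first exact: flow_scircuit.
- case/set0Pn: nzO' => e; rewrite -suppX => eX /ffunP/(_ e).
  by rewrite [RHS]ffunE => /eqP; rewrite signed_vector_eq0 eX.
- exact: signed_vector_mem.
apply: leq_trans (_ : #|supp X| <= 2)%N; last by rewrite suppX E1.
apply/subset_leq_card/subsetP=> e; rewrite inE signed_vector_eq0 negbK //.
Qed.
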